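(* Let $1^\emptyset$ be the mesh pattern consisting of the permutation $1$ with no shaded boxes. As $n$ tends to infinity, the proportion of mesh patterns $p$ of length $n$ (among all mesh patterns of length $n$) such that $\mu(1^\emptyset,p)=0$ approaches $1$, where $\mu$ is the Möbius function of the poset $\mathcal{M}$ of mesh patterns.
   Context: Mesh patterns. A permutation $\pi=\pi_1\cdots\pi_n$ ($n\ge 0$) is plotted as the points $(i,\pi_i)$, $1\le i\le n$. The boxes are the unit squares $[a,a+1]\times[b,b+1]$ with $0\le a,b\le n$; the box is denoted $(a,b)$ (its south-west corner). A mesh pattern is a pair $p=(p_{cl},p_{sh})$, also written $p_{cl}^{\,p_{sh}}$, where $p_{cl}$ is a permutation of length $n$ and $p_{sh}\subseteq\{0,\dots,n\}^2$ is a set of shaded boxes; its length is $|p|=n$. (So there are $n!\,2^{(n+1)^2}$ mesh patterns of length $n$.) Occurrences and the poset $\mathcal{M}$. An occurrence $\eta$ of a permutation $\sigma$ of length $k$ in $\pi$ is a subsequence of $\pi$ in the same relative order as $\sigma$. Let $q_1<\dots<q_k$ be its positions and $v_1<\dots<v_k$ its values in increasing order, and put $q_0=v_0=0$, $q_{k+1}=v_{k+1}=n+1$. For $0\le i,j\le k$ let $R_\eta(i,j)$ be the rectangle $[q_i,q_{i+1}]\times[v_j,v_{j+1}]$; it contains the boxes $(a,b)$ with $q_i\le a<q_{i+1}$, $v_j\le b<v_{j+1}$, and it contains a point of $\pi$ if that point is in its interior. An occurrence of a mesh pattern $(\sigma,S)$ in a mesh pattern $(\pi,P)$ is an occurrence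 $\eta$ of $\sigma$ in $\pi$ such that for every $(i,j)\in S$ the rectangle $R_\eta(i,j)$ contains no point of $\pi$ and every box in $R_\eta(i,j)$ belongs to $P$. $\mathcal{M}$ is the set of all mesh patterns ordered by $m\le p$ iff there is an occurrence of $m$ in $p$. Möbius function: $\mu(a,a)=1$, $\mu(a,b)=0$ if $a\not\le b$, and $\mu(a,b)=-\sum_{a\le c<b}\mu(a,c)$ if $a<b$. *)

(* Defs.v *)
From HB Require Import structures.
From mathcomp Require Import all_boot all_order all_fingroup all_algebra.

Set Implicit Arguments.
Unset Strict Implicit.
Unset Printing Implicit Defensive.

Import Order.TTheory GRing.Theory Num.Theory.

(* Permutations act on {0,...,n-1}: [i : 'I_n] stands for position [i.+1], and  *)
(* the permutation [s] is plotted as the points [(i.+1, (s i).+1)]. Boxes are   *)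
(* named by their south-west corner [(a, b)] with [0 <= a, b <= n].             *)
Definition mesh_of (n : nat) := ('S_n * {set 'I_n.+1 * 'I_n.+1})%type.

Lemma card_mesh_of n : #|{: mesh_of n}| = n`! * 2 ^ (n.+1 ^ 2).
Proof.
rewrite card_prod card_Sn; congr (_ * _).
by rewrite -[LHS]cardsT -powersetT card_powerset cardsT card_prod !card_ord.
Qed.

Definition mesh := {n : nat & mesh_of n}.
HB.instance Definition _ := Choice.on mesh.

Definition Mesh n (p : mesh_of n) : mesh := Tagged mesh_of p.
Definition mesh_len (p : mesh) : nat := tag p.
Definition mesh_cl (p : mesh) : 'S_(mesh_len p) := (tagged p).1.
Definition mesh_sh (p : mesh) : {set 'I_(mesh_len p).+1 * 'I_(mesh_len p).+1} :=
  (tagged p).2.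

(* A subsequence of length [k] of a permutation of length [n] is given by the   *)
(* increasing function [f] listing its positions.                               *)
Definition perm_occurrence k n (sigma : 'S_k) (pi : 'S_n)
    (f : {ffun 'I_k -> 'I_n}) : bool :=
  [forall i : 'I_k, forall j : 'I_k, (i < j) ==> (f i < f j)] &&
  [forall i : 'I_k, forall j : 'I_k,
     (sigma i < sigma j) == (pi (f i) < pi (f j))].

(* [occ_col f i] is q_i and [occ_row pi f j] is v_j, for 0 <= i, j <= k + 1.    *)
Definition occ_col k n (f : {ffun 'I_k -> 'I_n}) : nat -> nat :=
  nth 0 (0 :: rcons [seq (f i).+1 | i <- enum 'I_k] n.+1).

Definition occ_row k n (pi : 'S_n) (f : {ffun 'I_k -> 'I_n}) : nat -> nat :=
  nth 0 (0 :: rcons (sort leq [seq (pi (f i)).+1 | i <- enum 'I_k]) n.+1).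

Definition point_in_rect k n (pi : 'S_n) (f : {ffun 'I_k -> 'I_n})
    (i j : nat) (x : 'I_n) : bool :=
  (occ_col f i < x.+1 < occ_col f i.+1) &&
  (occ_row pi f j < (pi x).+1 < occ_row pi f j.+1).

Definition box_in_rect k n (pi : 'S_n) (f : {ffun 'I_k -> 'I_n})
    (i j : nat) (ab : 'I_n.+1 * 'I_n.+1) : bool :=
  (occ_col f i <= ab.1 < occ_col f i.+1) &&
  (occ_row pi f j <= ab.2 < occ_row pi f j.+1).

Definition mesh_occurrence (m p : mesh)
    (f : {ffun 'I_(mesh_len m) -> 'I_(mesh_len p)}) : bool :=
  perm_occurrence (mesh_cl m) (mesh_cl p) f &&
  [forall ij in mesh_sh m,
     [forall x, ~~ point_in_rect (mesh_cl p) f ij.1 ij.2 x] &&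
     [forall ab, box_in_rect (mesh_cl p) f ij.1 ij.2 ab ==> (ab \in mesh_sh p)]].

Definition mesh_le (m p : mesh) : bool :=
  [exists f : {ffun 'I_(mesh_len m) -> 'I_(mesh_len p)}, mesh_occurrence f].

Lemma grid_lt n s : sorted ltn s -> all (fun y => 0 < y < n.+1) s ->
  {in [pred i | i < (size s).+2] &,
    {mono nth 0 (0 :: rcons s n.+1) : i j / i < j}}.
Proof.
move=> srt al.
have tr : transitive ltn by move=> ? ? ?; apply: ltn_trans.
have H : sorted ltn (0 :: rcons s n.+1).
  rewrite (sorted_pairwise tr) pairwise_cons pairwise_rcons.
  rewrite -(sorted_pairwise tr) srt andbT all_rcons /=.
  by apply/andP; split; apply: sub_all al => y /andP[].
have G i j : i < (size s).+2 -> j < (size s).+2 -> i < j ->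
    nth 0 (0 :: rcons s n.+1) i < nth 0 (0 :: rcons s n.+1) j.
  by move=> hi hj; apply: (sorted_ltn_nth tr) => //; rewrite inE /= size_rcons.
move=> i j; rewrite !inE => hi hj.
have [ij|ji|->] := ltngtP i j; last by rewrite ltnn.
  exact: G.
by apply/negbTE; rewrite -leqNgt ltnW // G.
Qed.

Lemma grid_locate (G : nat -> nat) m x : G 0 <= x < G m.+1 ->
  exists2 c, c <= m & G c <= x < G c.+1.
Proof.
elim: m => [|m IH] /andP[h1 h2]; first by exists 0; rewrite ?h1.
have [h3|h3] := leqP (G m.+1) x; first by exists m.+1; rewrite ?h3.
by case: IH => [|c cm hc]; [rewrite h1 | exists c => //; apply: leqW].
Qed.

Lemma sorted_enum_map k (g : 'I_k -> nat) :
  (forall i j : 'I_k, i < j -> g i < g j) ->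
  sorted ltn [seq g i | i <- enum 'I_k].
Proof.
move=> H; rewrite sorted_map.
apply: (@sub_sorted _ (relpre val ltn)); first by move=> i j; apply: H.
by have := iota_ltn_sorted 0 k; rewrite -val_enum_ord sorted_map.
Qed.

Lemma occ_colS k n (f : {ffun 'I_k -> 'I_n}) (i : 'I_k) :
  occ_col f i.+1 = (f i).+1.
Proof.
rewrite /occ_col /= nth_rcons size_map size_enum_ord ltn_ord.
by rewrite (nth_map i) ?size_enum_ord // nth_ord_enum.
Qed.

Lemma occ_col_last k n (f : {ffun 'I_k -> 'I_n}) : occ_col f k.+1 = n.+1.
Proof. by rewrite /occ_col /= nth_rcons size_map size_enum_ord ltnn eqxx. Qed.

Lemma occ_row_last k n (pi : 'S_n) (f : {ffun 'I_k -> 'I_n}) :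
  occ_row pi f k.+1 = n.+1.
Proof.
by rewrite /occ_row /= nth_rcons size_sort size_map size_enum_ord ltnn eqxx.
Qed.

Lemma occ_incr k n (sigma : 'S_k) (pi : 'S_n) (f : {ffun 'I_k -> 'I_n})
    (i j : 'I_k) : perm_occurrence sigma pi f -> i < j -> f i < f j.
Proof. by case/andP => /forallP/(_ i)/forallP/(_ j)/implyP h _; apply: h. Qed.

Lemma occ_order k n (sigma : 'S_k) (pi : 'S_n) (f : {ffun 'I_k -> 'I_n})
    (i j : 'I_k) : perm_occurrence sigma pi f ->
  (sigma i < sigma j) = (pi (f i) < pi (f j)).
Proof. by case/andP => _ /forallP/(_ i)/forallP/(_ j)/eqP. Qed.

Lemma occ_inj k n (sigma : 'S_k) (pi : 'S_n) (f : {ffun 'I_k -> 'I_n}) :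
  perm_occurrence sigma pi f -> injective f.
Proof.
move=> occ i j fij; apply: val_inj; case: (ltngtP i j) => // h;
  by have := occ_incr occ h; rewrite fij ltnn.
Qed.

Lemma occ_sort_rows k n (sigma : 'S_k) (pi : 'S_n) (f : {ffun 'I_k -> 'I_n}) :
  perm_occurrence sigma pi f ->
  sort leq [seq (pi (f i)).+1 | i <- enum 'I_k] =
  [seq (pi (f (sigma^-1%g j))).+1 | j <- enum 'I_k].
Proof.
move=> occ; apply: (sorted_eq leq_trans anti_leq).
- exact: sort_sorted leq_total _.
- apply: (@sub_sorted _ ltn); first by move=> ? ? /ltnW.
  by apply: sorted_enum_map => i j ij; rewrite ltnS -(occ_order _ _ occ) !permKV.
rewrite perm_sort (map_comp (fun i => (pi (f i)).+1) sigma^-1%g).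
apply: perm_map; apply: uniq_perm; rewrite ?(map_inj_uniq perm_inj) ?enum_uniq //.
move=> i; rewrite mem_enum; apply/esym/mapP; exists (sigma i).
  by rewrite mem_enum.
by rewrite permK.
Qed.

Lemma occ_rowS k n (sigma : 'S_k) (pi : 'S_n) (f : {ffun 'I_k -> 'I_n})
    (i : 'I_k) : perm_occurrence sigma pi f ->
  occ_row pi f (sigma i).+1 = (pi (f i)).+1.
Proof.
move=> occ; rewrite /occ_row (occ_sort_rows occ) /=.
rewrite nth_rcons size_map size_enum_ord ltn_ord.
by rewrite (nth_map i) ?size_enum_ord // nth_ord_enum permK.
Qed.

Lemma occ_col_mono k n (sigma : 'S_k) (pi : 'S_n) (f : {ffun 'I_k -> 'I_n}) :
  perm_occurrence sigma pi f ->
  {in [pred i | i < k.+2] &, {mono occ_col f : i j / i < j}}.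
Proof.
move=> occ; have := @grid_lt n [seq (f i).+1 | i <- enum 'I_k].
rewrite size_map size_enum_ord; apply.
  by apply: sorted_enum_map => i j; apply: (occ_incr occ).
by apply/allP => y /mapP[i _ ->]; rewrite /= ltnS ltn_ord.
Qed.

Lemma occ_row_mono k n (sigma : 'S_k) (pi : 'S_n) (f : {ffun 'I_k -> 'I_n}) :
  perm_occurrence sigma pi f ->
  {in [pred i | i < k.+2] &, {mono occ_row pi f : i j / i < j}}.
Proof.
move=> occ.
have := @grid_lt n (sort leq [seq (pi (f i)).+1 | i <- enum 'I_k]).
rewrite size_sort size_map size_enum_ord; apply; rewrite (occ_sort_rows occ).
  by apply: sorted_enum_map => i j ij; rewrite ltnS -(occ_order _ _ occ) !permKV.
by apply/allP => y /mapP[i _ ->]; rewrite /= ltnS ltn_ord.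
Qed.

Lemma occ_comp k m n (sigma : 'S_k) (pi : 'S_m) (rho : 'S_n)
    (f : {ffun 'I_k -> 'I_m}) (g : {ffun 'I_m -> 'I_n}) :
  perm_occurrence sigma pi f -> perm_occurrence pi rho g ->
  perm_occurrence sigma rho [ffun i => g (f i)].
Proof.
move=> of_ og; apply/andP; split; apply/forallP => i; apply/forallP => j.
  by rewrite !ffunE; apply/implyP => ij; apply/(occ_incr og)/(occ_incr of_).
by rewrite !ffunE (occ_order _ _ of_) (occ_order _ _ og).
Qed.

Lemma ord_case k i : i < k.+2 ->
  [\/ i = 0, exists j : 'I_k, i = j.+1 | i = k.+1].
Proof.
case: i => [|i] hi; first by constructor 1.
have [ik|ki] := ltnP i k; first by constructor 2; exists (Ordinal ik).
by constructor 3; congr _.+1; apply/eqP; rewrite eqn_leq ki -ltnS -ltnS hi.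
Qed.

Lemma occ_col_comp k m n (f : {ffun 'I_k -> 'I_m}) (g : {ffun 'I_m -> 'I_n}) i :
  i < k.+2 -> occ_col [ffun i => g (f i)] i = occ_col g (occ_col f i).
Proof.
by case/ord_case => [->|[j ->]|->] //; rewrite ?occ_col_last // !occ_colS ffunE.
Qed.

Lemma occ_row_comp k m n (sigma : 'S_k) (pi : 'S_m) (rho : 'S_n)
    (f : {ffun 'I_k -> 'I_m}) (g : {ffun 'I_m -> 'I_n}) i :
  perm_occurrence sigma pi f -> perm_occurrence pi rho g -> i < k.+2 ->
  occ_row rho [ffun i => g (f i)] i = occ_row rho g (occ_row pi f i).
Proof.
move=> of_ og; case/ord_case => [->|[j ->]|->] //; rewrite ?occ_row_last //.
rewrite -[j](permKV sigma) (occ_rowS _ (occ_comp of_ og)).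
by rewrite (occ_rowS _ of_) (occ_rowS _ og) ffunE.
Qed.

Lemma mesh_leP (m p : mesh) : reflect
  (exists2 f : {ffun 'I_(mesh_len m) -> 'I_(mesh_len p)},
     perm_occurrence (mesh_cl m) (mesh_cl p) f &
     forall ij, ij \in mesh_sh m ->
       (forall x, ~~ point_in_rect (mesh_cl p) f ij.1 ij.2 x) /\
       (forall ab, box_in_rect (mesh_cl p) f ij.1 ij.2 ab -> ab \in mesh_sh p))
  (mesh_le m p).
Proof.
apply: (iffP existsP) => [[f /andP[of_ /forallP H]]|[f of_ H]]; exists f => //.
  move=> ij /(implyP (H ij)) /andP[/forallP h1 /forallP h2]; split=> // ab.
  exact: (implyP (h2 ab)).
apply/andP; split=> //; apply/forallP => ij; apply/implyP => /H[h1 h2].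
by apply/andP; split; apply/forallP => // ab; apply/implyP/h2.
Qed.

Lemma id_occ n (pi : 'S_n) : perm_occurrence pi pi [ffun i => i].
Proof.
apply/andP; split; apply/forallP => i; apply/forallP => j; rewrite !ffunE //.
exact: implybb.
Qed.

Lemma occ_col_id n i : i < n.+2 -> occ_col [ffun i : 'I_n => i] i = i.
Proof.
by case/ord_case => [->|[j ->]|->] //; rewrite ?occ_col_last // occ_colS ffunE.
Qed.

Lemma occ_row_id n (pi : 'S_n) i : i < n.+2 ->
  occ_row pi [ffun i : 'I_n => i] i = i.
Proof.
case/ord_case => [->|[j ->]|->] //; rewrite ?occ_row_last //.
by rewrite -[j](permKV pi) (occ_rowS _ (id_occ pi)) ffunE.
Qed.

Lemma mesh_le_refl : reflexive mesh_le.
Proof.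
move=> m; apply/mesh_leP; exists [ffun i => i]; first exact: id_occ.
move=> [i j] /= ijS; rewrite /point_in_rect /box_in_rect.
have hi : i < (mesh_len m).+2 by apply: leqW.
have hj : j < (mesh_len m).+2 by apply: leqW.
have hi1 : i.+1 < (mesh_len m).+2 by rewrite ltnS.
have hj1 : j.+1 < (mesh_len m).+2 by rewrite ltnS.
rewrite !occ_col_id // !occ_row_id //; split=> [x|[a b] /=].
  by apply/negP => /andP[/andP[h1 h2] _]; have := leq_trans h2 h1; rewrite ltnn.
rewrite !ltnS -!eqn_leq => /andP[/eqP ia /eqP jb].
by rewrite -(val_inj ia) -(val_inj jb).
Qed.

Lemma mesh_le_trans : transitive mesh_le.
Proof.
move=> p m r /mesh_leP[f of_ Hf] /mesh_leP[g og Hg].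
apply/mesh_leP; exists [ffun i => g (f i)]; first exact: occ_comp og.
have colP x : x < (mesh_len r).+1 ->
    exists c : 'I_(mesh_len p).+1, occ_col g c <= x < occ_col g c.+1.
  move=> hx; case: (@grid_locate (occ_col g) (mesh_len p) x).
    by rewrite occ_col_last.
  by move=> c cp h; exists (Ordinal (cp : c < _.+1)).
have rowP x : x < (mesh_len r).+1 ->
    exists c : 'I_(mesh_len p).+1,
    occ_row (mesh_cl r) g c <= x < occ_row (mesh_cl r) g c.+1.
  move=> hx; case: (@grid_locate (occ_row (mesh_cl r) g) (mesh_len p) x).
    by rewrite occ_row_last.
  by move=> c cp h; exists (Ordinal (cp : c < _.+1)).
have colM := occ_col_mono og; have rowM := occ_row_mono og.
have colB (i : nat) : i < (mesh_len m).+2 -> occ_col f i < (mesh_len p).+2.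
  by case/ord_case => [->|[j ->]|->] //; rewrite ?occ_col_last // occ_colS !ltnS ltnW.
have rowB (i : nat) : i < (mesh_len m).+2 ->
    occ_row (mesh_cl p) f i < (mesh_len p).+2.
  case/ord_case => [->|[j ->]|->] //; rewrite ?occ_row_last //.
  by rewrite -[j](permKV (mesh_cl m)) (occ_rowS _ of_) !ltnS ltnW.
have colL (i : 'I_(mesh_len m).+1) (c : 'I_(mesh_len p).+1) x :
    occ_col g c <= x < occ_col g c.+1 ->
    occ_col g (occ_col f i) <= x < occ_col g (occ_col f i.+1) ->
    occ_col f i <= c < occ_col f i.+1.
  move=> /andP[c1 c2] /andP[h1 h2]; apply/andP; split.
    rewrite -ltnS -colM ?inE; [exact: leq_ltn_trans c2| |by rewrite ltnS].
    by apply: colB; apply: leqW.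
  rewrite -colM ?inE; [exact: leq_ltn_trans h2|exact: leqW|].
  by apply: colB; rewrite ltnS.
have rowL (i : 'I_(mesh_len m).+1) (c : 'I_(mesh_len p).+1) x :
    occ_row (mesh_cl r) g c <= x < occ_row (mesh_cl r) g c.+1 ->
    occ_row (mesh_cl r) g (occ_row (mesh_cl p) f i) <= x <
      occ_row (mesh_cl r) g (occ_row (mesh_cl p) f i.+1) ->
    occ_row (mesh_cl p) f i <= c < occ_row (mesh_cl p) f i.+1.
  move=> /andP[c1 c2] /andP[h1 h2]; apply/andP; split.
    rewrite -ltnS -rowM ?inE; [exact: leq_ltn_trans c2| |by rewrite ltnS].
    by apply: rowB; apply: leqW.
  rewrite -rowM ?inE; [exact: leq_ltn_trans h2|exact: leqW|].
  by apply: rowB; rewrite ltnS.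
move=> [i j] ijS; have [/= Hf1 Hf2] := Hf _ ijS.
have hi : i < (mesh_len m).+2 by apply: leqW.
have hj : j < (mesh_len m).+2 by apply: leqW.
have hi1 : i.+1 < (mesh_len m).+2 by rewrite ltnS.
have hj1 : j.+1 < (mesh_len m).+2 by rewrite ltnS.
rewrite /= /point_in_rect /box_in_rect.
rewrite !occ_col_comp // !(occ_row_comp of_ og) //.
split=> [x|[a b] /= /andP[ha hb]]; last first.
  have [c hc] := colP a (ltn_ord a); have [d hd] := rowP b (ltn_ord b).
  have cdP : (c, d) \in mesh_sh p.
    by apply: Hf2; rewrite /box_in_rect /= (colL i c a) // (rowL j d b).
  by case: (Hg _ cdP) => _; apply; rewrite /box_in_rect /= hc.
apply/negP => /andP[hx hy].
have nimg y : x != g y.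
  apply/eqP => xE; move: hx hy; rewrite xE -(occ_rowS _ og) -occ_colS.
  have hS (z : 'I_(mesh_len p)) : z.+1 < (mesh_len p).+2 by rewrite !ltnS ltnW.
  rewrite !colM ?inE ?(colB _ hi) ?(colB _ hi1) ?hS //.
  rewrite !rowM ?inE ?(rowB _ hj) ?(rowB _ hj1) ?hS //.
  by move=> h1 h2; have /negP[] := Hf1 y; rewrite /point_in_rect h1 h2.
have [c hc] := colP x.+1 (ltn_ord x : x.+1 < _.+1).
have [d hd] := rowP (mesh_cl r x).+1 (ltn_ord (mesh_cl r x) : _.+1 < _.+1).
have cdP : (c, d) \in mesh_sh p.
  apply: Hf2; rewrite /box_in_rect /= (colL i c x.+1) //=.
    by rewrite (rowL j d (mesh_cl r x).+1) //; case/andP: hy => /ltnW-> ->.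
  by case/andP: hx => /ltnW-> ->.
have [/(_ x) + _] := Hg _ cdP; apply/negP; rewrite negbK.
rewrite /point_in_rect /=; case/andP: hc => c1 ->; case/andP: hd => d1 ->.
rewrite !andbT !ltn_neqAle c1 d1 !andbT; apply/andP; split.
  have [->|[y cE]|cE] := @ord_case (mesh_len p) c (leqW (ltn_ord c)) => //.
    by rewrite cE occ_colS eqSS eq_sym; apply: nimg.
  by move: (ltn_ord c); rewrite cE ltnn.
have [->|[y cE]|cE] := @ord_case (mesh_len p) d (leqW (ltn_ord d)) => //.
  rewrite cE -[y](permKV (mesh_cl p)) (occ_rowS _ og) eqSS.
  apply: contraNneq (nimg ((mesh_cl p)^-1%g y)) => h.
  by apply/eqP/(@perm_inj _ (mesh_cl r))/val_inj.
by move: (ltn_ord d); rewrite cE ltnn.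
Qed.

Definition mesh_rank (p : mesh) : nat := mesh_len p + #|mesh_sh p|.

Lemma mesh_le_len (m p : mesh) : mesh_le m p -> mesh_len m <= mesh_len p.
Proof.
case/mesh_leP=> f /occ_inj fI _.
by have := leq_card _ fI; rewrite !card_ord.
Qed.

Lemma mesh_le_card_sh (m p : mesh) : mesh_le m p -> #|mesh_sh m| <= #|mesh_sh p|.
Proof.
case/mesh_leP=> f of_ Hf.
have colM := occ_col_mono of_; have rowM := occ_row_mono of_.
have colB (i : 'I_(mesh_len m).+1) : occ_col f i < (mesh_len p).+1.
  rewrite -(occ_col_last f) colM ?inE // ltnS; exact: ltnW.
have rowB (i : 'I_(mesh_len m).+1) : occ_row (mesh_cl p) f i < (mesh_len p).+1.
  rewrite -(occ_row_last (mesh_cl p) f) rowM ?inE // ltnS; exact: ltnW.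
pose F (ij : 'I_(mesh_len m).+1 * 'I_(mesh_len m).+1) :=
  (Ordinal (colB ij.1), Ordinal (rowB ij.2)).
have mono_inj (G : nat -> nat) (i j : 'I_(mesh_len m).+1) :
    {in [pred i | i < (mesh_len m).+2] &, {mono G : i j / i < j}} ->
    G i = G j -> i = j.
  move=> M E; apply: val_inj => /=.
  have hi : i < (mesh_len m).+2 by apply: leqW.
  have hj : j < (mesh_len m).+2 by apply: leqW.
  by case: (ltngtP i j) => //; rewrite -M ?inE // E ltnn.
have FI : injective F.
  move=> [i j] [i' j'] [] /(mono_inj _ _ _ colM) -> /(mono_inj _ _ _ rowM) ->.
  by [].
rewrite -(card_imset _ FI); apply/subset_leq_card/subsetP => _ /imsetP[[i j] ijS ->].
case: (Hf _ ijS) => _; apply; rewrite /box_in_rect /=.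
have hS (i0 : 'I_(mesh_len m).+1) :
    (i0 < (mesh_len m).+2) && (i0.+1 < (mesh_len m).+2).
  by rewrite (leqW (ltn_ord i0)) ltnS ltn_ord.
have [/andP[hi hi1] /andP[hj hj1]] := (hS i, hS j).
by rewrite !leqnn colM ?inE ?hi ?hi1 // rowM ?inE ?hj ?hj1 // !leqnn.
Qed.

Lemma incr_id n (f : 'I_n -> 'I_n) :
  (forall i j : 'I_n, i < j -> f i < f j) -> f =1 id.
Proof.
move=> H i; apply: val_inj => /=.
have fI : injective f.
  move=> a b fab; apply: val_inj; case: (ltngtP a b) => // h;
  by have := H _ _ h; rewrite fab ltnn.
have E : [seq (f i : nat) | i <- enum 'I_n] = iota 0 n.
  apply: (@irr_sorted_eq _ ltn) => //.
  - by move=> ? ? ?; apply: ltn_trans.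
  - exact: ltnn.
  - exact: sorted_enum_map.
  - exact: iota_ltn_sorted.
  move=> x; rewrite mem_iota /=; apply/mapP/idP => [[j _ ->] //|xn].
  have [g gK Kg] := injF_bij fI.
  by exists (g (Ordinal xn)); rewrite ?mem_enum // Kg.
have := nth_iota 0 0 (ltn_ord i).
by rewrite -E (nth_map i) ?size_enum_ord // nth_ord_enum add0n.
Qed.

Lemma mesh_le_same_len n (s t : mesh_of n) :
  mesh_le (Mesh s) (Mesh t) -> s.1 = t.1 /\ s.2 \subset t.2.
Proof.
case/mesh_leP=> /= f of_ Hf.
have fE : f = [ffun i => i].
  apply/ffunP => i; rewrite ffunE.
  by apply: incr_id => a b; apply: (occ_incr of_).
have cE : s.1 = t.1.
  apply: (mulgI s.1^-1%g); rewrite mulVg; apply/permP => i.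
  rewrite permM perm1; apply: esym.
  move: i; apply: (@incr_id n (fun i => t.1 (s.1^-1%g i))) => i j ij.
  have := occ_order (s.1^-1%g i) (s.1^-1%g j) of_.
  by rewrite /= !permKV ij fE !ffunE => <-.
split=> //; apply/subsetP => -[i j] ijS.
case: (Hf _ ijS) => _; apply; rewrite fE /box_in_rect /=.
have hi : i < n.+2 by apply: leqW.
have hj : j < n.+2 by apply: leqW.
have hi1 : i.+1 < n.+2 by rewrite ltnS.
have hj1 : j.+1 < n.+2 by rewrite ltnS.
by rewrite !occ_col_id // !occ_row_id // !leqnn.
Qed.

Lemma mesh_le_rank (m p : mesh) : mesh_le m p -> m != p ->
  mesh_rank m < mesh_rank p.
Proof.
move=> mp; have := mesh_le_len mp; have := mesh_le_card_sh mp.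
rewrite leq_eqVlt /mesh_rank => c l; case/predU1P: c => [cE|]; last first.
  by move=> c; rewrite -addnS leq_add.
rewrite cE ltn_add2r; case: m p mp l cE => [k s] [n t] mp l cE mNp.
rewrite ltn_neqAle l andbT; apply: contra mNp => /eqP /= E.
subst k; have [h1 h2] := mesh_le_same_len mp.
have h3 : s.2 = t.2 by apply/eqP; rewrite eqEcard h2 /= -[X in X <= _]cE.
by apply/eqP; rewrite [s]surjective_pairing h1 h3 -surjective_pairing.
Qed.

Lemma mesh_le_anti : antisymmetric mesh_le.
Proof.
move=> m p /andP[mp pm]; apply/eqP; apply: contraT => mNp.
have := mesh_le_rank mp mNp; rewrite ltnNge ltnW // mesh_le_rank //.
by rewrite eq_sym.
Qed.

Fact mesh_display : Order.disp_t. Proof. exact: Order.Disp tt tt. Qed.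

HB.instance Definition _ :=
  Order.Le_isPOrder.Build mesh_display mesh mesh_le_refl mesh_le_anti mesh_le_trans.

Lemma mesh_leE (m p : mesh) : (m <= p)%O = mesh_le m p.
Proof. by []. Qed.

Lemma mesh_lt_rank (m p : mesh) : (m < p)%O -> mesh_rank m < mesh_rank p.
Proof. by rewrite lt_neqAle => /andP[mNp mp]; apply: mesh_le_rank. Qed.

(* Every [c <= b] has length at most [mesh_len b], so the double sum ranges     *)
(* over the whole interval [a <= c < b]. The first argument is fuel, and        *)
(* [(mesh_rank b).+1] is enough of it: see [mobiusE].                           *)
Fixpoint mobius_rec (fuel : nat) (a b : mesh) : int :=
  (if fuel is d.+1 then
     if a == b then 1
     else if (a < b)%O then
       - \sum_(k < (mesh_len b).+1) \sum_(c : mesh_of k | (a <= Mesh c < b)%O)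
            mobius_rec d a (Mesh c)
     else 0
   else 0)%R.

Definition mobius (a b : mesh) : int := mobius_rec (mesh_rank b).+1 a b.

Lemma mobiusE (a b : mesh) : mobius a b =
  (if a == b then 1
   else if (a < b)%O then
     - \sum_(k < (mesh_len b).+1) \sum_(c : mesh_of k | (a <= Mesh c < b)%O)
          mobius a (Mesh c)
   else 0)%R.
Proof.
have H d : forall e c, mesh_rank c < d -> mesh_rank c < e ->
    mobius_rec d a c = mobius_rec e a c.
  elim: d => [//|d IH] [//|e] c hd he /=; do 2!case: ifP => // _.
  congr (- _)%R; apply: eq_bigr => l _.
  by apply: eq_bigr => x /andP[_ /mesh_lt_rank xc]; apply: IH; apply: leq_trans xc _.
rewrite {1}/mobius /=; do 2!case: ifP => // _.
congr (- _)%R; apply: eq_bigr => k _.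
by apply: eq_bigr => c /andP[_ /mesh_lt_rank cb]; apply: H.
Qed.

Definition one_empty : mesh := Mesh ((1%g, set0) : mesh_of 1).

(* Main.v *)
Require Import Defs.
From HB Require Import structures.
From mathcomp Require Import all_boot all_order all_fingroup all_algebra.
From mathcomp Require Import zify ring lra.

Set Implicit Arguments.
Unset Strict Implicit.
Unset Printing Implicit Defensive.

Import Order.TTheory GRing.Theory Num.Theory.
Local Open Scope ring_scope.

(** Call q unshaded if its shading is empty, and write 1^S for the mesh pattern
    of length 1 with shading S, 1^0 being the unshaded one.

    If p is shaded and no 1^S with S nonempty lies below p, then
    mu(1^0, p) = 0 ([mobius_one_empty_eq0]). Indeed, removing the whole shading
    is a decreasing closure operator on the open interval (1^0, p): it never
    falls down to 1^0, since only a shaded pattern of length 1 is sent there.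
    Its image is the set of unshaded patterns strictly between 1^0 and p, and it
    has a greatest element, p without its shading; so the open interval is
    contractible. The proof below is the arithmetic version of this argument.
    By induction the shaded patterns strictly below p contribute 0 to the sum
    defining mu(1^0, p), and the remaining ones form the closed interval from
    1^0 to the unshaded copy of p, over which mu sums to 0.

    Almost every p satisfies the hypothesis. An occurrence of 1^S with S
    nonempty needs a point of p with one of its four quadrants entirely shaded
    ([shaded_point_quadrant]). For a corner of the square and a position and
    value lying in the A-th column and the B-th row counted from that corner,
    the quadrant has AB boxes, so the proportion of patterns with a point there
    and with that quadrant shaded is (1/n) 2^-(AB) ([card_quadrant_shaded]). As
    AB >= A + B - 1 for A, B >= 1, summing over A and B gives at most 2/n
    ([quadrant_sum_le2]), hence 8/n for the four corners. Unshaded patterns have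
    proportion at most 1/n, so the patterns to be excluded have proportion at
    most 9/n ([exceptional_ratio]). *)

(** * Vanishing of the Moebius function *)

Lemma mobius_interval_sum (a b : mesh) : (a < b)%O ->
  \sum_(k < (mesh_len b).+1) \sum_(c : mesh_of k | (a <= Mesh c <= b)%O)
     mobius a (Mesh c) = 0.
Proof.
move=> ab.
have split_top (k : 'I_(mesh_len b).+1) :
    \sum_(c : mesh_of k | (a <= Mesh c <= b)%O) mobius a (Mesh c) =
    \sum_(c : mesh_of k | (a <= Mesh c < b)%O) mobius a (Mesh c) +
    \sum_(c : mesh_of k | Mesh c == b) mobius a (Mesh c).
  rewrite (bigID (fun c : mesh_of k => Mesh c == b)) /= addrC; congr (_ + _).
    by apply: eq_bigl => c; rewrite lt_neqAle -andbA [X in _ && X]andbC.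
  apply: eq_bigl => c; rewrite andb_idl // => /eqP->.
  by rewrite lexx (ltW ab).
rewrite (eq_bigr _ (fun k _ => split_top k)) big_split /=.
have -> : \sum_(k < (mesh_len b).+1) \sum_(c : mesh_of k | Mesh c == b)
    mobius a (Mesh c) = mobius a b.
  rewrite big_ord_recr /= big1 => [|k _]; last first.
    apply: big_pred0 => c; apply/negbTE/eqP => cb.
    by have := ltn_ord k; rewrite /= -[X in (_ < X)%N](congr1 mesh_len cb) ltnn.
  case: b ab split_top => n b _ _; rewrite add0r (big_pred1 b) // => c /=.
  by rewrite /Mesh eq_Tagged.
by rewrite mobiusE (lt_eqF ab) ab subrr.
Qed.

Definition unshade (p : mesh) : mesh := Mesh (mesh_cl p, set0).

(** An empty shading imposes no condition on an occurrence, and conversely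
    nothing shaded fits below an unshaded pattern: this identifies a lower
    interval of unshaded patterns inside the lower interval of [p]. *)
Lemma le_unshade (m p : mesh) :
  (m <= unshade p)%O = (m <= p)%O && (mesh_sh m == set0).
Proof.
apply/idP/andP => [mp|[mp /eqP m0]].
  have m0 : mesh_sh m = set0.
    apply/eqP; rewrite -cards_eq0 -leqn0.
    by have := mesh_le_card_sh mp; rewrite [X in (_ <= X)%N]cards0.
  split; last by rewrite m0.
  case/mesh_leP: mp => f occ _; apply/mesh_leP; exists f => // ij.
  by rewrite m0 inE.
case/mesh_leP: mp => f occ _; apply/mesh_leP; exists f => // ij.
by rewrite m0 inE.
Qed.

(** The hypothesis on patterns of length 1 is inherited by everything below [p],
    so an induction on the rank disposes of the shaded patterns below [p]. *)
Lemma mobius_one_empty_eq0 (p : mesh) : mesh_sh p != set0 ->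
  (forall q : mesh_of 1, (Mesh q <= p)%O -> q.2 = set0) ->
  mobius one_empty p = 0.
Proof.
elim: {p}_.+1 {-2}p (ltnSn (mesh_rank p)) => // r IH p pr p_sh no1.
rewrite mobiusE; case: eqP => [pE|_].
  by move: p_sh; rewrite -pE /mesh_sh eqxx.
case: ifP => // one_p; apply/eqP; rewrite oppr_eq0; apply/eqP.
(* Otherwise [p] has length 1 and is itself a forbidden shaded pattern. *)
have one_u : (one_empty < unshade p)%O.
  rewrite lt_neqAle le_unshade (ltW one_p) eqxx !andbT.
  apply: contraNneq p_sh => oneE.
  case: p oneE no1 {pr one_p} => n p oneE no1.
  have n1 : n = 1%N := esym (congr1 mesh_len oneE).
  by subst n; apply/eqP/no1/lexx.
(* The sum below [p] reduces to its unshaded terms, that is, to the sum over the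
   closed interval up to [unshade p]. *)
rewrite -[RHS](mobius_interval_sum one_u); apply: eq_bigr => k _.
rewrite (bigID (fun c : mesh_of k => c.2 == set0)) /= [X in _ + X]big1 ?addr0.
  apply: eq_bigl => c; rewrite le_unshade andbA -[LHS]andbA -[RHS]andbA.
  congr (_ && _).
  apply/andP/andP => -[cp c0]; split=> //; first exact: ltW.
  rewrite lt_neqAle cp andbT; apply: contraNneq p_sh => <-; exact: c0.
move=> c /andP[/andP[_ cp] c_sh]; apply: IH => //.
  by apply: leq_trans (mesh_lt_rank cp) _; rewrite -ltnS.
by move=> q qc; apply: no1; apply: le_trans qc (ltW cp).
Qed.

(** * Shaded quadrants *)

(** Points are indexed from 0, so the grid line through the point [i] is the one
    numbered [i.+1], and the box [i] is the last one before it. *)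
Definition side n (a : bool) (i : 'I_n) : {set 'I_n.+1} :=
  [set x : 'I_n.+1 | if a then (i < x)%N else (x <= i)%N].

Definition quadrant n (ab : bool * bool) (ij : 'I_n * 'I_n) :
  {set 'I_n.+1 * 'I_n.+1} := setX (side ab.1 ij.1) (side ab.2 ij.2).

(** The single point of [q] splits the square into four rectangles, which an
    occurrence in [p] maps to the four quadrants around a point of [p]; the
    rectangle of any shaded box of [q] has to be shaded in [p]. *)
Lemma shaded_point_quadrant n (q : mesh_of 1) (p : mesh_of n) :
  (Mesh q <= Mesh p)%O -> q.2 != set0 ->
  exists ab i, quadrant ab (i, p.1 i) \subset p.2.
Proof.
case/mesh_leP => /= f occ Hf /set0Pn[[u v] uv].
have [_ boxes] := Hf _ uv.
exists ((u : nat) == 1%N, (v : nat) == 1%N), (f ord0).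
apply/subsetP => -[x y]; rewrite !inE /= => /andP[hx hy].
apply: boxes; rewrite /box_in_rect.
have c1 : occ_col f 1 = (f ord0).+1 := occ_colS f ord0.
have c2 : occ_col f 2 = n.+1 := occ_col_last f.
have r1 : occ_row p.1 f 1 = (p.1 (f ord0)).+1.
  by rewrite -(occ_rowS ord0 occ) (ord1 (_ ord0)).
have r2 : occ_row p.1 f 2 = n.+1 := occ_row_last p.1 f.
have [c0 r0] : occ_col f 0 = 0%N /\ occ_row p.1 f 0 = 0%N by [].
rewrite /mesh_cl /=; move: (occ_col f) (occ_row p.1 f) c0 c1 c2 r0 r1 r2 => c r.
move=> c0 c1 c2 r0 r1 r2; have [ltx lty] := (ltn_ord x, ltn_ord y).
case: u v hx hy {uv} => [[|[|//]] ?] [[|[|//]] ?] /= hx hy;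
  rewrite ?(c0, c1, c2) ?(r0, r1, r2); lia.
Qed.

(** * Counting exceptional patterns *)

(** Multiplying by a transposition of values shows that all [n] possible values
    at [i] are taken equally often. *)
Lemma card_perm_at n (i j : 'I_n) :
  (n * #|[set s : 'S_n | s i == j]|)%N = n`!.
Proof.
pose E k := [set s : 'S_n | s i == k].
have cardE k : #|E k| = #|E j|.
  rewrite -(card_imset (E k) (mulIg (tperm k j))); apply: eq_card => s.
  rewrite inE; apply/imsetP/idP => [[t]|/eqP si].
    by rewrite !inE => /eqP ti ->; rewrite permM ti tpermL.
  exists (s * tperm k j)%g; last by rewrite -mulgA tperm2 mulg1.
  by rewrite inE permM si tpermR.
rewrite -card_Sn -[RHS]sum1_card.
rewrite (partition_big (fun s : 'S_n => s i) xpredT) //=.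
rewrite -[X in (X * _)%N]card_ord -sum_nat_const; apply: eq_bigr => k _.
rewrite -(cardE k) -sum1_card; apply: eq_bigl => s; by rewrite inE.
Qed.

Lemma card_supersets (T : finType) (Q : {set T}) :
  (2 ^ #|Q| * #|[set S : {set T} | Q \subset S]|)%N = (2 ^ #|T|)%N.
Proof.
rewrite -(cardsC Q) expnD -card_powerset; congr (_ * _)%N.
rewrite -card_powerset -(card_imset _ (@setC_inj T)); apply: eq_card => S.
rewrite inE; apply/imsetP/idP => [[S' + ->]|SQ].
  by rewrite inE setCS.
by exists (~: S); rewrite ?setCK // inE -setCS setCK.
Qed.

(** The permutation and the shading are chosen independently, so the proportion
    of these patterns is [1 / n] times [2 ^- #|quadrant ab ij|]. *)
Lemma card_quadrant_shaded n ab (ij : 'I_n * 'I_n) :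
  (n * 2 ^ #|quadrant ab ij| *
    #|[set p : mesh_of n | (p.1 ij.1 == ij.2) && (quadrant ab ij \subset p.2)]|)%N
  = #|{: mesh_of n}|.
Proof.
rewrite card_prod card_Sn -(card_perm_at ij.1 ij.2).
rewrite -[in RHS]cardsT -[in RHS]powersetT card_powerset cardsT.
rewrite -(card_supersets (quadrant ab ij)) mulnACA -cardsX; congr (_ * _)%N.
by apply: eq_card => p; rewrite !inE.
Qed.

Lemma card_side n a (i : 'I_n) :
  #|side a i| = (if a then rev_ord i : nat else i).+1.
Proof.
have le_card m : (m <= n)%N -> #|[set x : 'I_n.+1 | (x <= m)%N]| = m.+1.
  move=> mn; rewrite -sum1dep_card (big_ord_narrow_leq mn).
  by rewrite sum1_card card_ord.
case: a; last by rewrite /side le_card // ltnW.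
rewrite -(le_card (rev_ord i)) ?(ltnW (ltn_ord _)) //.
rewrite -[RHS](card_imset _ (@rev_ord_inj n.+1)).
apply: eq_card => x; rewrite [LHS]inE.
have [ltx lti] := (ltn_ord x, ltn_ord i).
apply/idP/imsetP => [xi|[y + ->]]; last by rewrite inE /=; lia.
by exists (rev_ord x); rewrite ?rev_ordK // inE /=; lia.
Qed.

Lemma half_sum_le1 (F : realFieldType) n :
  \sum_(i < n) 2^-1 ^+ i.+1 <= 1 :> F.
Proof.
suff -> : \sum_(i < n) 2^-1 ^+ i.+1 = 1 - 2^-1 ^+ n :> F.
  by rewrite gerBl exprn_ge0 ?invr_ge0 ?ler0n.
elim: n => [|n IH]; first by rewrite big_ord0 expr0 subrr.
by rewrite big_ord_recr /= IH exprS; lra.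
Qed.

(** The sizes of the sides at the various points are [1, ..., n] in some order,
    which makes this a geometric sum. *)
Lemma side_sum_le1 (F : realFieldType) n a :
  \sum_(i < n) 2^-1 ^+ #|side a i| <= 1 :> F.
Proof.
under eq_bigr do rewrite card_side.
case: a; last exact: half_sum_le1.
by rewrite (reindex_inj rev_ord_inj); under eq_bigr do rewrite rev_ordK;
  exact: half_sum_le1.
Qed.

(** The bound [A + B - 1] for the area [A * B] separates the two coordinates, and
    the double sum becomes twice a product of two geometric sums. *)
Lemma quadrant_sum_le2 (F : realFieldType) n ab :
  \sum_(ij : 'I_n * 'I_n) 2^-1 ^+ #|quadrant ab ij| <= 2 :> F.
Proof.
pose w a (i : 'I_n) : F := 2^-1 ^+ #|side a i|.
have w_ge0 a i : 0 <= w a i by rewrite exprn_ge0 ?invr_ge0 ?ler0n.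
have sums_le1 a : \sum_(i < n) w a i <= 1 by apply: side_sum_le1.
apply: (@le_trans _ _ (\sum_i \sum_j 2 * (w ab.1 i * w ab.2 j))).
  rewrite pair_big; apply: ler_sum => -[i j] _ /=.
  (* Both sides are nonempty, so the predecessor is a genuine subtraction. *)
  have -> : 2 * (w ab.1 i * w ab.2 j) =
      2^-1 ^+ (#|side ab.1 i| + #|side ab.2 j|).-1.
    rewrite /w -exprD; case E: (_ + _)%N => [|m].
      by move: E; rewrite !card_side.
    by rewrite exprS mulrA divff ?mul1r // pnatr_eq0.
  apply: ler_wiXn2l; rewrite ?invr_ge0 ?invf_le1 ?ler1n //.
  by rewrite cardsX !card_side; nia.
under eq_bigr do rewrite -mulr_sumr -mulr_sumr.
rewrite -mulr_sumr -mulr_suml -[X in _ <= X]mulr1 ler_pM2l //.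
by rewrite mulr_ile1 // sumr_ge0.
Qed.

Definition exceptional n : {set mesh_of n} :=
  [set p : mesh_of n | p.2 == set0] :|:
  [set p : mesh_of n | [exists x : (bool * bool) * 'I_n,
     quadrant x.1 (x.2, p.1 x.2) \subset p.2]].

Lemma mobius_nonexceptional n (p : mesh_of n) :
  p \notin exceptional n -> mobius one_empty (Mesh p) = 0.
Proof.
rewrite !inE negb_or => /andP[p_sh /existsPn noq].
apply: mobius_one_empty_eq0 => // q qp; apply/eqP; apply: contraT => q_sh.
have [ab [i sub]] := shaded_point_quadrant qp q_sh.
by have := noq (ab, i); rewrite sub.
Qed.

(** Union bound over the four corners and the [n ^ 2] places for a point. *)
Lemma exceptional_ratio (F : realFieldType) n : (0 < n)%N ->
  #|exceptional n|%:R / #|{: mesh_of n}|%:R <= 9 / n%:R :> F.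
Proof.
move=> n_gt0; set M := #|{: mesh_of n}|.
have n_gt0' : 0 < n%:R :> F by rewrite ltr0n.
have M_gt0 : 0 < M%:R :> F.
  by rewrite ltr0n /M card_mesh_of muln_gt0 fact_gt0 expn_gt0.
pose shaded ab (ij : 'I_n * 'I_n) := [set p : mesh_of n |
  (p.1 ij.1 == ij.2) && (quadrant ab ij \subset p.2)].
pose unshaded := [set p : mesh_of n | p.2 == set0].
have shadedE ab ij :
    #|shaded ab ij|%:R = M%:R / n%:R * 2^-1 ^+ #|quadrant ab ij| :> F.
  rewrite /M -(card_quadrant_shaded ab ij) !natrM natrX exprVn.
  by rewrite -/(shaded ab ij); field; rewrite expf_neq0 ?pnatr_eq0 -?lt0n.
have unshaded_le : #|unshaded|%:R <= M%:R / n%:R :> F.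
  rewrite ler_pdivlMr // -natrM ler_nat /M card_mesh_of.
  have -> : #|unshaded| = n`!.
    rewrite -card_Sn -[RHS]cardsT.
    have pair_inj : injective (fun s : 'S_n => (s, set0) : mesh_of n).
      by move=> ? ? [].
    rewrite -(card_imset _ pair_inj); apply: eq_card => -[s S].
    rewrite inE /=; apply/eqP/imsetP => [->|[t _ [_ ->]]] //.
    by exists s.
  rewrite leq_mul2l (leq_trans (ltnW (ltn_expl n (ltnSn 1)))) ?orbT //.
  by rewrite leq_exp2l //; nia.
(* A point of [p] at position [i] is counted at the place [(i, p.1 i)]. *)
have cover :
    (#|exceptional n| <= #|unshaded| + \sum_ab \sum_ij #|shaded ab ij|)%N.
  apply: leq_trans (leq_of_leqif (leq_card_setU _ _)) _; rewrite leq_add2l.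
  rewrite pair_big /=.
  apply: (@leq_trans #|\bigcup_x shaded x.1 x.2|); last first.
    apply: (big_ind2 (fun (A : {set mesh_of n}) m => (#|A| <= m)%N)) => //.
      by rewrite cards0.
    move=> A m B k Am Bk.
    by apply: leq_trans (leq_of_leqif (leq_card_setU _ _)) _; apply: leq_add.
  apply/subset_leq_card/subsetP => p; rewrite inE => /existsP[[ab i] sub].
  by apply/bigcupP; exists (ab, (i, p.1 i)) => //; rewrite inE eqxx.
have quadrants_le ab :
    \sum_ij #|shaded ab ij|%:R <= M%:R / n%:R * 2 :> F.
  under eq_bigr do rewrite shadedE.
  rewrite -mulr_sumr ler_wpM2l ?quadrant_sum_le2 //.
  by rewrite divr_ge0 // ltW.
rewrite ler_pdivrMr //.
apply: (@le_trans _ _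
  (M%:R / n%:R + \sum_(ab : bool * bool) M%:R / n%:R * 2)).
  apply: (@le_trans _ _ (#|unshaded| + \sum_ab \sum_ij #|shaded ab ij|)%:R).
    by rewrite ler_nat.
  rewrite natrD natr_sum; apply: lerD => //.
  by apply: ler_sum => ab _; rewrite natr_sum.
rewrite sumr_const card_prod card_bool -[X in _ + X]mulr_natr.
by rewrite le_eqVlt; apply/orP; left; apply/eqP; field; rewrite gt_eqF.
Qed.

(** * The limit *)

From mathcomp Require Import all_classical all_reals all_analysis.
Import numFieldNormedType.Exports.
Local Open Scope classical_set_scope.

Theorem corollary3p9 (R : realType) :
  (fun n : nat =>
     (#|[pred p : mesh_of n | mobius one_empty (Mesh p) == 0]|%:R
        / #|{: mesh_of n}|%:R : R)) @ \oo --> (1 : R).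
Proof.
(* [9 / n <= 18 / n.+1] for [n > 0] turns the bound into a multiple of the
   harmonic sequence. *)
apply: (@squeeze_cvgr _ _ _ _ (fun n => 1 - 18 * harmonic n) (fun=> 1));
  last 2 first.
- rewrite -[X in _ --> X]subr0 -(mulr0 18); apply: cvgB; first exact: cvg_cst.
  by apply: cvgMl_tmp; exact: cvg_harmonic.
- exact: cvg_cst.
exists 1%N => // n /= n_gt0.
set Z := [pred p | _]; set M := #|{: mesh_of n}|.
have M_gt0 : 0 < M%:R :> R.
  by rewrite ltr0n /M card_mesh_of muln_gt0 fact_gt0 expn_gt0.
apply/andP; split; last by rewrite ler_pdivrMr // mul1r ler_nat max_card.
have MZ : (M <= #|Z| + #|exceptional n|)%N.
  rewrite /M -(cardsC (exceptional n)) addnC leq_add2r.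
  apply: subset_leq_card; apply/fintype.subsetP => p.
  rewrite finset.inE => /mobius_nonexceptional p0.
  by rewrite inE p0.
have n_gt0' : 0 < n%:R :> R by rewrite ltr0n.
have bound_le : 9 / n%:R <= 18 / n.+1%:R :> R.
  rewrite ler_pdivrMr // mulrAC ler_pdivlMr ?ltr0n //.
  by rewrite -!natrM ler_nat; lia.
rewrite lerBlDr -[leLHS](divff (lt0r_neq0 M_gt0)).
apply: (@le_trans _ _ ((#|Z| + #|exceptional n|)%:R / M%:R)).
  by rewrite ler_pM2r ?invr_gt0 // ler_nat.
rewrite natrD mulrDl lerD2l; apply: le_trans bound_le.
exact: exceptional_ratio.
Qed.
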